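(* Let $\mu$ be the Gibbs distribution of a $q$-state spin system with $n=|V|$ vertices, and let $\kappa\in(0,1)$. (1) If $\mu$ is $\kappa$-contractive with respect to the Glauber dynamics and an arbitrary $w$-weighted Hamming metric (with $w:V\to\mathbb R_+$ an arbitrary positive weight function), then $\mu$ is spectrally independent with constant $\eta=\frac{2}{(1-\kappa)n}$. In particular, if $\kappa\le1-\frac{\epsilon}{n}$ for some $\epsilon>0$, then $\eta\le\frac2\epsilon$. (2) If the metric in (1) is not a weighted Hamming metric but instead an arbitrary $\gamma$-equivalent metric ($\gamma\ge1$), then $\mu$ is spectrally independent with constant $\eta=\frac{2\gamma^2}{(1-\kappa)n}$. In particular, if $\kappa\le1-\frac\epsilon n$ for some $\epsilon>0$, then $\eta\le\frac{2\gamma^2}{\epsilon}$.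
   Context: Spin system. Let $q\ge2$, $[q]=\{1,\dots,q\}$, and let $G=(V\cup\partial V,E\cup\partial E)$ be a finite graph, where $\partial V$ is a (possibly empty) boundary set, $E$ is the set of edges inside $V$ and $\partial E$ the set of edges between $V$ and $\partial V$; $n=|V|$. Given nonnegative symmetric matrices $A_{xy}\in\mathbb R_+^{q\times q}$ for $\{x,y\}\in E\cup\partial E$, vectors $B_x\in\mathbb R_+^q$ for $x\in V$, and a boundary condition $\xi\in[q]^{\partial V}$, a configuration $\sigma\in[q]^V$ has weight $w(\sigma)=\prod_{\{x,y\}\in E}A_{xy}(\sigma_x,\sigma_y)\prod_{\{x,y\}\in\partial E,\,x\in V,\,y\in\partial V}A_{xy}(\sigma_x,\xi_y)\prod_{x\in V}B_x(\sigma_x)$. Let $\Omega=\{\sigma:w(\sigma)>0\}$ (assumed nonempty); the Gibbs distribution is $\mu(\sigma)\propto w(\sigma)$ on $\Omega$. Pinnings. For $U\subset V$, $\Omega_U$ is the set of $\tau\in[q]^U$ that extend to an element of $\Omega$; $\mathcal T=\bigcup_{U\subset V}\Omega_U$ is the set of pinnings. For $\tau\in\Omega_U$, $\mu^\tau=\mu(\cdot\mid\sigma_U=\tau)$ with support $\Omega^\tau$; $\Omega_x^\tau$ is the set of spins possible at $x$ under $\mu^\tau$; $\mathcal X^\tau=\{(x,a):x\in V\setminus U,a\in\Omega^\tau_x\}$. Standing assumption: $\mu$ is totally-connected, i.e. for every pinning $\tau$ the set $\Omega^\tau$ is connected under moves between configurations at Hamming distance 1. Spectral independence. $J^\tau\in\mathbb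 R^{\mathcal X^\tau\times\mathcal X^\tau}$ has entries $J^\tau(x,a;x,a')=0$ and $J^\tau(x,a;y,a')=\mu^\tau(\sigma_y=a'\mid\sigma_x=a)-\mu^\tau(\sigma_y=a')$ for $x\neq y$; its eigenvalues are real. $\mu$ is spectrally independent with constant $\eta$ if the largest eigenvalue satisfies $\lambda_1(J^\tau)\le\eta$ for all $\tau\in\mathcal T$. Glauber dynamics with pinnings. For $\tau\in\Omega_U$, the chain $P^\tau$ on $\Omega^\tau$ picks a vertex $x\in V$ uniformly at random (pinned vertices included) and resamples its spin from $\mu$ conditioned on the spins of all other vertices and on $\tau$; if $x\in U$ nothing changes. Contraction. Let $\mathcal P=\{P^\tau:\tau\in\mathcal T\}$, where $P^\tau$ has stationary distribution $\mu^\tau$, and let $d$ be a metric on $\Omega$. $\mu$ is $\kappa$-contractive w.r.t. $\mathcal P$ and $d$ if for all $\tau\in\mathcal T$ and all $X_0,Y_0\in\Omega^\tau$ there is a coupling $(X_0,Y_0)\to(X_1,Y_1)$ of one step of $P^\tau$ with $\mathbb E[d(X_1,Y_1)\mid X_0,Y_0]\le\kappa\,d(X_0,Y_0)$. Metrics. Hamming metric $d_{\mathrm H}(\sigma,\tau)=|\{x:\sigma_x\ne\tau_x\}|$; $w$-weighted Hamming metric $d_w(\sigma,\tau)=\sum_{x\in V}w(x)\mathbf 1\{\sigma_x\ne\tau_x\}$; a metric $d$ on $\Omega$ is $\gamma$-equivalent if $\frac1\gamma d_{\mathrm H}\le d\le\gamma d_{\mathrm H}$ on $\Omega\times\Omega$.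 *)

(* Defs.v *)
From HB Require Import structures.
From mathcomp Require Import all_boot all_order all_algebra.
From mathcomp Require Import reals.

Set Implicit Arguments.
Unset Strict Implicit.
Unset Printing Implicit Defensive.

Import Order.TTheory GRing.Theory Num.Theory.
Local Open Scope ring_scope.

Section FiniteProbability.
Variables (R : realType) (T : finType).
Implicit Types (p : T -> R) (A B : pred T).

Definition prob p A : R := \sum_(s | A s) p s.

(* Equal to 0 when B has probability 0, because x / 0 = 0. *)
Definition cprob p A B : R := prob p (predI A B) / prob p B.

Definition coupling (p1 p2 : T -> R) (pi : T * T -> R) : Prop :=
  [/\ forall st, 0 <= pi st,
      forall s, \sum_t pi (s, t) = p1 s
    & forall t, \sum_s pi (s, t) = p2 t].

Definition metric_on (D : {set T}) (d : T -> T -> R) : Prop :=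
  [/\ {in D &, forall s t, 0 <= d s t},
      {in D &, forall s t, d s t = 0 <-> s = t},
      {in D &, forall s t, d s t = d t s}
    & {in D & &, forall s t r, d s r <= d s t + d t r}].

End FiniteProbability.

(* A spin system on a finite simple graph with vertex set V and boundary dV;
   an unordered edge {x, y} is represented by both pairs (x, y) and (y, x).
   The spins 1, ..., q are represented by 'I_q. *)
Record spin_system (R : realType) (q : nat) (V dV : finType) := SpinSystem {
  edge : rel V;
  bedge : V -> dV -> bool;
  inter : V -> V -> 'M[R]_q;
  binter : V -> dV -> 'M[R]_q;
  ext_field : V -> 'rV[R]_q;
  bcond : {ffun dV -> 'I_q};
  edge_sym : symmetric edge;
  edge_irr : irreflexive edge;
  inter_edge : forall x y, edge x y -> inter x y = inter y x;
  inter_tr : forall x y, edge x y -> (inter x y)^T = inter x y;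
  inter_ge0 : forall x y a b, edge x y -> 0 <= inter x y a b;
  binter_tr : forall x z, bedge x z -> (binter x z)^T = binter x z;
  binter_ge0 : forall x z a b, bedge x z -> 0 <= binter x z a b;
  ext_field_ge0 : forall x a, 0 <= ext_field x 0 a
}.

Section SpinSystem.
Variables (R : realType) (q : nat) (V dV : finType).
Variable S : spin_system R q V dV.

Local Notation config := {ffun V -> 'I_q}.

(* [tau x = Some a] means that x is pinned to a, so the pinned set U is
   [set x | tau x != None]. *)
Local Notation partial_config := {ffun V -> option 'I_q}.

Implicit Types (s t : config) (tau : partial_config).

(* [enum_rank] selects one of the two orientations of each edge, so that each
   edge contributes one factor; by [edge_sym], [inter_edge] and [inter_tr] the
   product does not depend on the selection. *)
Definition weight s : R :=
  (\prod_(e : V * V | edge S e.1 e.2 && (enum_rank e.1 < enum_rank e.2)%N)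
      inter S e.1 e.2 (s e.1) (s e.2))
  * (\prod_(e : V * dV | bedge S e.1 e.2)
      binter S e.1 e.2 (s e.1) (bcond S e.2))
  * \prod_x ext_field S x 0 (s x).

Definition Omega : {set config} := [set s | 0 < weight s].

Definition gibbs s : R := weight s / \sum_t weight t.

Definition agrees tau : pred config :=
  fun s => [forall x, if tau x is Some a then s x == a else true].

Definition pinning tau : bool := [exists s in Omega, agrees tau s].

Definition gibbs_pin tau s : R := cprob gibbs (pred1 s) (agrees tau).

Definition Omega_pin tau : {set config} := [set s | 0 < gibbs_pin tau s].

Definition spin_at (x : V) (a : 'I_q) : pred config := fun s => s x == a.

Definition Omega_at tau (x : V) : {set 'I_q} :=
  [set a | 0 < prob (gibbs_pin tau) (spin_at x a)].

Definition free_pairs tau : {set V * 'I_q} :=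
  [set xa | (tau xa.1 == None) && (xa.2 \in Omega_at tau xa.1)].

Definition hamming s t : nat := #|[set x | s x != t x]|.

Definition totally_connected : Prop :=
  forall tau, pinning tau ->
    {in Omega_pin tau &, forall s t,
      connect [rel r r' | [&& r \in Omega_pin tau, r' \in Omega_pin tau
                            & hamming r r' == 1%N]] s t}.

Definition influence tau (xa yb : V * 'I_q) : R :=
  if xa.1 == yb.1 then 0
  else cprob (gibbs_pin tau) (spin_at yb.1 yb.2) (spin_at xa.1 xa.2)
       - prob (gibbs_pin tau) (spin_at yb.1 yb.2).

Definition influence_mx tau : 'M[R]_#|free_pairs tau| :=
  \matrix_(i, j) influence tau (enum_val i) (enum_val j).

(* The influence matrix has only real eigenvalues, so bounding its largest
   eigenvalue is bounding all its eigenvalues in R.  If every vertex is pinned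
   the matrix is empty and the condition is void. *)
Definition spectrally_independent (eta : R) : Prop :=
  forall tau, pinning tau ->
    forall lambda, eigenvalue (influence_mx tau) lambda -> lambda <= eta.

(* The vertex x is uniform in V, and its spin is resampled given tau and the
   spins of s at all other vertices. *)
Definition glauber tau s t : R :=
  #|V|%:R^-1 *
  \sum_x cprob (gibbs_pin tau) (pred1 t)
               (fun r => [forall y, (y != x) ==> (r y == s y)]).

(* Only the values of d on Omega matter when, as for [glauber], [P tau s] is
   supported in [Omega_pin tau] for s in [Omega_pin tau]. *)
Definition contractive (P : partial_config -> config -> config -> R)
    (d : config -> config -> R) (kappa : R) : Prop :=
  forall tau, pinning tau ->
    {in Omega_pin tau &, forall s0 t0,
      exists2 pi : config * config -> R,
        coupling (P tau s0) (P tau t0) pi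
        & \sum_st pi st * d st.1 st.2 <= kappa * d s0 t0}.

Definition weighted_hamming (w : V -> R) s t : R :=
  \sum_(x | s x != t x) w x.

Definition equivalent_metric (gamma : R) (d : config -> config -> R) : Prop :=
  metric_on Omega d /\
  {in Omega &, forall s t,
    gamma^-1 * (hamming s t)%:R <= d s t <= gamma * (hamming s t)%:R}.

End SpinSystem.

(* Main.v *)
Require Import Defs.
From mathcomp Require Import all_boot all_order all_algebra.
From mathcomp Require Import reals.
From mathcomp Require Import ring lra.

Import Order.TTheory GRing.Theory Num.Theory.
Local Open Scope ring_scope.

(** Contraction of the Glauber dynamics bounds every row of the influence
    matrix in a weighted l1 norm, and hence its eigenvalues.

    Fix a pinning tau, write m for the pinned Gibbs measure and P for its
    Glauber dynamics on the n = #|V| vertices, and let nu be m conditioned on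
    the spin at x being a.  For a function f that is L-Lipschitz with respect
    to d on the support of m, stationarity of m gives
      nu f - m f = nu (f - P f) + (nu (P f) - m (P f)).
    The heat-bath update at a vertex y <> x preserves nu as well, because it is
    reversible for m and does not touch the spin at x; so only the update at x
    contributes to the first term, which is therefore at most L c / n, where c
    bounds the distance between configurations that differ at x only
    ([tilted_mean_chain]).  The contraction hypothesis makes P f
    (kappa L)-Lipschitz ([apply_chain_lipschitz]), so the identity can be
    iterated, and summing the geometric series gives
      nu f - m f <= L c / ((1 - kappa) n)
    ([tilted_mean_contraction]).

    Apply this to f s = \sum_y w y * sg (J (x, a) (y, s y)), where J is the
    influence function.  Then nu f - m f is exactly the w-weighted l1 norm of the
    influences of (x, a) on all pairs (y, b), which dominates that of its row of
    the influence matrix, while f is 2-Lipschitz for the w-weighted Hamming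
    metric ([influence_row_sum]).  A left eigenvector argument turns these row bounds
    into a bound on the eigenvalues ([eigenvalue_le_weighted_row_sum]).

    Both parts are instances of one statement about a function d comparable,
    up to constants A and B, with a weighted Hamming metric
    ([contractive_spectrally_independent]): A = B = 1 in the first part, and
    w = 1, A = B = gamma in the second. *)

(** * Geometric decay *)

Lemma le_of_le_add_geometric (R : archiRealFieldType) (kappa a b x : R) :
  0 <= kappa -> kappa < 1 -> (forall k, x <= a + kappa ^+ k * b) -> x <= a.
Proof.
move=> k0 k1 H; rewrite leNgt; apply/negP => ax.
(* A term of the geometric series is at most the average of the partial sum:
   k kappa^k <= 1 + kappa + ... + kappa^(k-1). *)
have geom k : k%:R * (1 - kappa) * kappa ^+ k <= 1 - kappa ^+ k.
  elim: k => [|k IH]; first by rewrite !mul0r expr0 subrr.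
  have kk : 0 <= kappa ^+ k by rewrite exprn_ge0.
  have kk1 : kappa ^+ k <= 1 by rewrite exprn_ile1 // ltW.
  rewrite exprSr -[k.+1]addn1 natrD.
  have := ler_wpM2l k0 IH.
  have : 0 <= (1 - kappa) * (1 - kappa ^+ k * kappa).
    by rewrite mulr_ge0 ?subr_ge0 ?mulr_ile1 // ltW.
  lra.
have b0 : 0 < b by have := H 0%N; rewrite expr0; lra.
have bound k : k%:R * (1 - kappa) * (x - a) <= b.
  have /(ler_wpM2l (_ : 0 <= k%:R * (1 - kappa))) := H k.
  rewrite mulr_ge0 ?ler0n ?subr_ge0 ?(ltW k1) // => /(_ isT) Hk.
  have := ler_wpM2r (ltW b0) (geom k).
  have kk : 0 <= kappa ^+ k by rewrite exprn_ge0.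
  by move=> G; have := mulr_ge0 kk (ltW b0); nra.
have p : 0 < (1 - kappa) * (x - a) by rewrite mulr_gt0 // subr_gt0.
have := archi_boundP (ltW (divr_gt0 b0 p)).
by rewrite ltr_pdivrMr // ltNge mulrA bound.
Qed.

(** * Heat-bath updates *)

Section HeatBath.
Set Implicit Arguments.
Unset Strict Implicit.
Context {R : realType} {V K : finType}.
Local Notation T := {ffun V -> K}.
Implicit Types (x y : V) (s t : T) (f g : T -> R) (L : R).

(** The configurations that agree with s away from x. *)
Definition agree_off x s : pred T :=
  fun r => [forall y, (y != x) ==> (r y == s y)].

Lemma agree_offP x s t :
  reflect (forall y, y != x -> t y = s y) (agree_off x s t).
Proof.
apply: (iffP forallP) => H y; first by move/(implyP (H y))/eqP.
by apply/implyP => /H ->.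
Qed.

Lemma agree_off_refl x s : agree_off x s s.
Proof. exact/agree_offP. Qed.

Lemma agree_offC x s t : agree_off x s t = agree_off x t s.
Proof. by apply/agree_offP/agree_offP => H y /H. Qed.

Lemma eq_agree_off x s t : agree_off x s t -> agree_off x s =1 agree_off x t.
Proof.
move=> /agree_offP st r; apply/agree_offP/agree_offP => H y yx.
  by rewrite H // st.
by rewrite H // st.
Qed.

Variable m : T -> R.
Hypothesis m_ge0 : forall s, 0 <= m s.

(** Probability that resampling the spin at x, conditionally on all the other
    spins, moves s to t. *)
Definition heat_bath x s t : R := cprob m (pred1 t) (agree_off x s).

Lemma heat_bathE x s t :
  heat_bath x s t = if agree_off x s t then m t / prob m (agree_off x s) else 0.
Proof.
rewrite /heat_bath /cprob {1}/prob.
case: ifP => st.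
  rewrite (eq_bigl (pred1 t)) ?big_pred1_eq // => r /=.
  by case: eqP => // ->.
rewrite big_pred0 ?mul0r // => r /=.
by case: eqP => // ->.
Qed.

Lemma prob_ge0 (A : pred T) : 0 <= prob m A.
Proof. exact: sumr_ge0. Qed.

Lemma heat_bath_ge0 x s t : 0 <= heat_bath x s t.
Proof. by rewrite heat_bathE; case: ifP => // _; rewrite divr_ge0 ?prob_ge0. Qed.

Lemma heat_bath_supp x s t : heat_bath x s t != 0 -> 0 < m t /\ agree_off x s t.
Proof.
rewrite heat_bathE; case: ifP => [_|_ /eqP //] nz; split=> //.
by rewrite lt0r m_ge0 andbT; apply: contraNneq nz => ->; rewrite mul0r.
Qed.

Lemma heat_bath_reversible x s t :
  m s * heat_bath x s t = m t * heat_bath x t s.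
Proof.
rewrite !heat_bathE [agree_off x t s]agree_offC.
case: ifP => [st|_]; last by rewrite !mulr0.
rewrite /prob (eq_bigl _ _ (eq_agree_off st)); ring.
Qed.

Lemma heat_bath_sum1 x s : 0 < m s -> \sum_t heat_bath x s t = 1.
Proof.
move=> ms; under eq_bigr do rewrite heat_bathE.
rewrite -big_mkcond -mulr_suml mulfV // gt_eqF // /prob.
by rewrite (bigD1 s) ?agree_off_refl //= ltr_pwDl // sumr_ge0.
Qed.

(** By reversibility, an update at x preserves every measure whose density g
    with respect to m does not depend on the spin at x. *)
Lemma heat_bath_invariant x g f :
    (forall s t, agree_off x s t -> g s = g t) ->
  \sum_s m s * g s * (\sum_t heat_bath x s t * f t) = \sum_s m s * g s * f s.
Proof.
move=> gx; under eq_bigr do rewrite mulr_sumr.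
rewrite exchange_big; apply: eq_bigr => t _ /=.
transitivity (\sum_s m t * g t * f t * heat_bath x t s).
  apply: eq_bigr => s _.
  have [/gx -> |ns] := boolP (agree_off x s t).
    by have := heat_bath_reversible x s t; move=> E; ring: E.
  by rewrite !heat_bathE [agree_off x t s]agree_offC (negbTE ns) mul0r !mulr0.
rewrite -mulr_sumr; have := m_ge0 t; rewrite le0r => /orP[/eqP->|mt].
  by rewrite !mul0r.
by rewrite heat_bath_sum1 // mulr1.
Qed.

(** * Contraction of Lipschitz functions *)

(** One step of the heat-bath (Glauber) dynamics at a uniform random vertex. *)
Definition heat_bath_chain s t : R := #|V|%:R^-1 * \sum_x heat_bath x s t.

(** The action of the chain on functions: the expectation of f after one step
    from s. *)
Definition apply_chain f s : R := \sum_t heat_bath_chain s t * f t.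

Lemma apply_chainE f s :
  apply_chain f s = #|V|%:R^-1 * \sum_x \sum_t heat_bath x s t * f t.
Proof.
rewrite /apply_chain exchange_big mulr_sumr; apply: eq_bigr => t _ /=.
by rewrite /heat_bath_chain -mulrA mulr_suml.
Qed.

(** f is L-Lipschitz with respect to d on the support of m.  No absolute value
    is needed, since s and t may be exchanged when d is symmetric. *)
Definition lipschitz (d : T -> T -> R) L f : Prop :=
  forall s t, 0 < m s -> 0 < m t -> f s - f t <= L * d s t.

Lemma heat_bath_chain_supp s t : heat_bath_chain s t != 0 -> 0 < m t.
Proof.
move=> nz; have [mt|mt] := ltP 0 (m t) => //.
case/eqP: nz; rewrite /heat_bath_chain big1 ?mulr0 // => x _.
by apply: contraTeq mt => /heat_bath_supp[mt _]; rewrite -ltNge.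
Qed.

Lemma apply_chain_lipschitz d (kappa : R) L f :
    (forall s t, 0 < m s -> 0 < m t -> exists2 pi : T * T -> R,
       coupling (heat_bath_chain s) (heat_bath_chain t) pi
       & \sum_st pi st * d st.1 st.2 <= kappa * d s t) ->
  0 <= L -> lipschitz d L f -> lipschitz d (kappa * L) (apply_chain f).
Proof.
move=> contr L0 lf s t ms mt; have [pi [pi0 piL piR] le_pi] := contr s t ms mt.
have -> : apply_chain f s = \sum_st pi st * f st.1.
  rewrite (eq_bigr (fun st => pi (st.1, st.2) * f st.1)); last by case.
  rewrite -(pair_bigA _ (fun u v => pi (u, v) * f u)) /=.
  by apply: eq_bigr => u _; rewrite -piL mulr_suml.
have -> : apply_chain f t = \sum_st pi st * f st.2.
  rewrite (eq_bigr (fun st => pi (st.1, st.2) * f st.2)); last by case.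
  rewrite -(pair_bigA _ (fun u v => pi (u, v) * f v)) exchange_big /=.
  by apply: eq_bigr => v _; rewrite -piR mulr_suml.
rewrite -sumrB.
apply: (@le_trans _ _ (L * \sum_st pi st * d st.1 st.2)); last first.
  by rewrite [kappa * L]mulrC -mulrA ler_wpM2l.
rewrite mulr_sumr; apply: ler_sum => -[u v] _ /=.
have := pi0 (u, v); rewrite le0r => /orP[/eqP->|pi_gt0].
  by rewrite !mul0r subr0 mulr0.
rewrite -mulrBr mulrCA ler_wpM2l //; apply: lf.
  apply: (@heat_bath_chain_supp s); rewrite -piL gt_eqF // (bigD1 v) //=.
  by rewrite ltr_pwDl // sumr_ge0.
apply: (@heat_bath_chain_supp t); rewrite -piR gt_eqF // (bigD1 u) //=.
by rewrite ltr_pwDl // sumr_ge0.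
Qed.

Lemma chain_stationary f : (0 < #|V|)%N ->
  \sum_s m s * apply_chain f s = \sum_s m s * f s.
Proof.
move=> V0; have V1 : #|V|%:R != 0 :> R by rewrite pnatr_eq0 -lt0n.
apply: (mulfI V1); rewrite mulr_sumr.
under eq_bigr do rewrite apply_chainE mulrCA mulVKf // mulr_sumr.
rewrite exchange_big /= -sum1_card natr_sum mulr_suml; apply: eq_bigr => y _.
have := @heat_bath_invariant y (fun=> 1) f (fun _ _ _ => erefl).
rewrite mul1r => inv.
transitivity (\sum_s m s * 1 * \sum_t heat_bath y s t * f t).
  by apply: eq_bigr => s _; rewrite mulr1.
by rewrite inv; apply: eq_bigr => s _; rewrite mulr1.
Qed.

(* A probability measure m and a probability density g with respect to it that
   depends on the spin at x only. *)
Hypothesis m_sum1 : \sum_s m s = 1.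

Variables (x : V) (g : T -> R).
Hypothesis g_ge0 : forall s, 0 <= g s.
Hypothesis g_local : forall s t, s x = t x -> g s = g t.
Hypothesis g_mean1 : \sum_s m s * g s = 1.

(** Only the update at x moves the measure of density g. *)
Lemma tilted_mean_chain f :
  \sum_s m s * g s * f s - \sum_s m s * g s * apply_chain f s =
  #|V|%:R^-1 * \sum_s m s * g s * \sum_t heat_bath x s t * (f s - f t).
Proof.
have V0 : #|V|%:R != 0 :> R by rewrite pnatr_eq0 -lt0n; apply/card_gt0P; exists x.
apply: (mulfI V0); rewrite mulVKf // mulrBr.
have -> : #|V|%:R * (\sum_s m s * g s * apply_chain f s)
          = \sum_y \sum_s m s * g s * \sum_t heat_bath y s t * f t.
  rewrite exchange_big mulr_sumr; apply: eq_bigr => s _ /=.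
  by rewrite apply_chainE -mulr_sumr mulrCA mulVKf.
have stat y : y != x ->
    \sum_s m s * g s * (\sum_t heat_bath y s t * f t) = \sum_s m s * g s * f s.
  move=> yx; apply: heat_bath_invariant => s t /agree_offP st.
  by apply: g_local; rewrite st // eq_sym.
rewrite (bigD1 x) //= (eq_bigr _ stat) sumr_const cardC1 mulr_natl.
have -> : #|V| = #|V|.-1.+1 by rewrite prednK //; apply/card_gt0P; exists x.
rewrite mulrS /= opprD addrACA subrr addr0 -sumrB.
apply: eq_bigr => s _; rewrite -mulrBr.
have := m_ge0 s; rewrite le0r => /orP[/eqP->|ms]; first by rewrite !mul0r.
congr (_ * _); under [RHS]eq_bigr do rewrite mulrBr.
by rewrite sumrB -mulr_suml heat_bath_sum1 // mul1r.
Qed.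

(** The means of a Lipschitz function under m and under the measure of density
    g are close; c bounds the displacement caused by an update at x. *)
Lemma tilted_mean_contraction (d : T -> T -> R) (kappa c L : R) f :
    0 <= kappa -> kappa < 1 ->
    (forall s t, 0 < m s -> 0 < m t -> exists2 pi : T * T -> R,
       coupling (heat_bath_chain s) (heat_bath_chain t) pi
       & \sum_st pi st * d st.1 st.2 <= kappa * d s t) ->
    0 <= c ->
    (forall s t, 0 < m s -> 0 < m t -> agree_off x s t -> d s t <= c) ->
    0 <= L -> lipschitz d L f ->
  \sum_s m s * g s * f s - \sum_s m s * f s <= L * c / ((1 - kappa) * #|V|%:R).
Proof.
move=> k0 k1 contr c0 dc L0 lf.
(* D bounds the initial error: it is the mean distance between independent
   samples of the two measures. *)
pose D := \sum_s \sum_t m s * g s * m t * d s t.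
have V0 : (0 < #|V|)%N by apply/card_gt0P; exists x.
have V1 : 0 < #|V|%:R :> R by rewrite ltr0n.
apply: (@le_of_le_add_geometric _ kappa _ (L * D)) => // k.
elim: k L L0 f lf => [|k IH] L L0 f lf.
  rewrite expr0 mul1r -[leLHS]add0r; apply: lerD.
    by rewrite divr_ge0 ?mulr_ge0 ?ler0n // subr_ge0 ltW.
  rewrite -{1}[X in _ - X]mul1r -g_mean1 mulr_suml -sumrB mulr_sumr.
  apply: ler_sum => s _; rewrite -{1}[_ * f s]mulr1 -m_sum1 !mulr_sumr -sumrB.
  apply: ler_sum => t _.
  have := m_ge0 s; rewrite le0r => /orP[/eqP->|ms]; first by lra.
  have := m_ge0 t; rewrite le0r => /orP[/eqP->|mt]; first by lra.
  have gs0 := g_ge0 s.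
  have -> : m s * g s * f s * m t - m s * g s * (m t * f t)
            = m s * g s * m t * (f s - f t) by ring.
  by rewrite mulrCA ler_wpM2l ?lf // !mulr_ge0.
have step : \sum_s m s * g s * f s - \sum_s m s * g s * apply_chain f s
            <= #|V|%:R^-1 * (L * c).
  rewrite tilted_mean_chain ler_wpM2l ?invr_ge0 ?ler0n //.
  rewrite -[leRHS]mul1r -g_mean1 mulr_suml; apply: ler_sum => s _.
  have := m_ge0 s; rewrite le0r => /orP[/eqP->|ms]; first by rewrite !mul0r.
  rewrite ler_wpM2l ?mulr_ge0 ?(ltW ms) //.
  rewrite -[leRHS]mul1r -(heat_bath_sum1 x ms) mulr_suml.
  apply: ler_sum => t _.
  have [->|/heat_bath_supp[mt st]] := eqVneq (heat_bath x s t) 0.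
    by rewrite !mul0r.
  rewrite ler_wpM2l ?heat_bath_ge0 //; apply: le_trans (lf _ _ ms mt) _.
  by rewrite ler_wpM2l // dc.
have kL0 : 0 <= kappa * L by rewrite mulr_ge0.
have := IH _ kL0 _ (apply_chain_lipschitz contr L0 lf).
rewrite chain_stationary // => IHf.
have -> : L * c / ((1 - kappa) * #|V|%:R) + kappa ^+ k.+1 * (L * D) =
    #|V|%:R^-1 * (L * c) +
    (kappa * L * c / ((1 - kappa) * #|V|%:R) + kappa ^+ k * (kappa * L * D)).
  by rewrite exprS; field; rewrite gt_eqF // subr_eq0 eq_sym lt_eqF.
lra.
Qed.

End HeatBath.
(** * Eigenvalues and weighted row sums *)

(** If v is a left eigenvector, the weighted l1 norm of v *m A is at most C
    times that of v. *)
Lemma eigenvalue_le_weighted_row_sum (F : realFieldType) n (A : 'M[F]_n)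
    (w : 'I_n -> F) (C lambda : F) :
    (forall i, 0 < w i) ->
    (forall i, \sum_j `|A i j| * w j <= C * w i) ->
  eigenvalue A lambda -> lambda <= C.
Proof.
move=> w0 rowA /eigenvalueP[v vA v0].
have [k vk] : exists k, v 0 k != 0.
  by apply/existsP; apply: contraNT v0 => /existsPn v0; apply/eqP/rowP => k;
     rewrite mxE; apply/eqP/negPn/v0.
have N0 : 0 < \sum_j `|v 0 j| * w j.
  rewrite (bigD1 k) //= ltr_pwDl ?mulr_gt0 ?normr_gt0 //.
  by apply: sumr_ge0 => j _; rewrite mulr_ge0 // ltW.
rewrite -(ler_pM2r N0); apply: le_trans (ler_wpM2r (ltW N0) (ler_norm _)) _.
apply: (@le_trans _ _ (\sum_j \sum_i `|v 0 i| * (`|A i j| * w j))).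
  rewrite mulr_sumr; apply: ler_sum => j _.
  rewrite mulrA -normrM; have := congr1 (fun u : 'rV_n => u 0 j) vA.
  rewrite /= !mxE => <-; under eq_bigr do rewrite mulrA -normrM.
  by rewrite -mulr_suml ler_wpM2r ?ler_norm_sum // ltW.
rewrite exchange_big mulr_sumr; apply: ler_sum => i _ /=.
by rewrite -mulr_sumr mulrCA ler_wpM2l.
Qed.

(** * Pinned Gibbs measures *)

Section SpectralIndependence.
Set Implicit Arguments.
Unset Strict Implicit.
Context {R : realType} {q : nat} {V dV : finType} (S : spin_system R q V dV).
Local Notation config := {ffun V -> 'I_q}.
Local Notation partial_config := {ffun V -> option 'I_q}.
Implicit Types (s t : config) (tau : partial_config).

Lemma weight_ge0 s : 0 <= weight S s.
Proof.
rewrite /weight !mulr_ge0 ?prodr_ge0 // => [e /andP[E _]|e E|x _].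
- exact: inter_ge0.
- exact: binter_ge0.
- exact: ext_field_ge0.
Qed.

Lemma gibbs_ge0 s : 0 <= gibbs S s.
Proof.
by rewrite divr_ge0 ?sumr_ge0 ?weight_ge0 // => t _; exact: weight_ge0.
Qed.

Lemma gibbs_pinE tau s :
  gibbs_pin S tau s =
  if agrees tau s then gibbs S s / prob (gibbs S) (agrees tau) else 0.
Proof.
rewrite /gibbs_pin /cprob {1}/prob; case: ifP => st.
  rewrite (eq_bigl (pred1 s)) ?big_pred1_eq // => r /=.
  by case: eqP => // ->.
by rewrite big_pred0 ?mul0r // => r /=; case: eqP => // ->.
Qed.

Lemma gibbs_pin_ge0 tau s : 0 <= gibbs_pin S tau s.
Proof.
rewrite gibbs_pinE; case: ifP => // _.
by rewrite divr_ge0 ?gibbs_ge0 ?sumr_ge0 // => t _; exact: gibbs_ge0.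
Qed.

Lemma gibbs_pin_sum1 tau : pinning S tau -> \sum_s gibbs_pin S tau s = 1.
Proof.
case/exists_inP => s; rewrite inE => ws As.
under eq_bigr do rewrite gibbs_pinE.
rewrite -big_mkcond -mulr_suml mulfV // gt_eqF // /prob (bigD1 s) //=.
rewrite ltr_pwDl ?sumr_ge0 //; last by move=> t _; exact: gibbs_ge0.
rewrite divr_gt0 // (bigD1 s) //= ltr_pwDl ?sumr_ge0 // => t _.
exact: weight_ge0.
Qed.

Lemma Omega_pin_sub tau s : s \in Omega_pin S tau -> s \in Omega S.
Proof.
rewrite !inE [0 < weight S s]lt0r weight_ge0 andbT; apply: contraTneq => w0.
by rewrite gibbs_pinE /gibbs w0 !mul0r; case: ifP; rewrite ltxx.
Qed.

(** * Rows of the influence matrix *)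

Section InfluenceRow.
Variables (tau : partial_config) (x : V) (a : 'I_q).
Local Notation m := (gibbs_pin S tau).
Hypothesis tau_pin : pinning S tau.
Hypothesis p_gt0 : 0 < prob m (spin_at x a).

(* The density, with respect to the pinned Gibbs measure, of its conditioning
   on the spin at x being a. *)
Let g s : R := (s x == a)%:R / prob m (spin_at x a).

(** The weighted l1 norm of the influences of (x, a) is attained by the test
    function f built from their signs. *)
Lemma influence_row_test (w : V -> R) :
  let f s := \sum_y w y * Num.sg (influence S tau (x, a) (y, s y)) in
  \sum_(yb : V * 'I_q) `|influence S tau (x, a) yb| * w yb.1
  = \sum_s m s * g s * f s - \sum_s m s * f s.
Proof.
move=> f.
(* Split the sum over s according to the value of s y. *)
have mean (h : config -> R) : \sum_s h s * f s =
    \sum_(yb : V * 'I_q) w yb.1 * Num.sg (influence S tau (x, a) yb)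
                         * \sum_(s | spin_at yb.1 yb.2 s) h s.
  under eq_bigr do rewrite mulr_sumr.
  rewrite exchange_big /=.
  rewrite [RHS](eq_bigr (fun yb : V * 'I_q =>
      w yb.1 * Num.sg (influence S tau (x, a) (yb.1, yb.2))
      * \sum_(s | spin_at yb.1 yb.2 s) h s)); last by case.
  rewrite -(pair_bigA _ (fun y b => w y * Num.sg (influence S tau (x, a) (y, b))
      * \sum_(s | spin_at y b s) h s)) /=.
  apply: eq_bigr => y _; rewrite (partition_big (fun s : config => s y) xpredT) //=.
  apply: eq_bigr => b _; rewrite mulr_sumr; apply: eq_bigr => s /eqP ->.
  by rewrite mulrC.
rewrite !mean -sumrB; apply: eq_bigr => -[y b] _ /=.
have -> : \sum_(s | spin_at y b s) m s * g s
          = cprob m (spin_at y b) (spin_at x a).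
  rewrite /cprob {1}/prob mulr_suml big_mkcond [RHS]big_mkcond /=.
  apply: eq_bigr => s _; rewrite /g /spin_at /=.
  by case: eqP => //= _; case: eqP => _; rewrite ?mul1r // !mul0r mulr0.
rewrite -mulrBr normrEsg; have [xy|xy] := eqVneq x y.
  by rewrite /influence /= xy eqxx sgr0 !mulr0 !mul0r.
by rewrite {2}/influence /= (negbTE xy) /prob; ring.
Qed.

Lemma influence_row_sum (w : V -> R) (d : config -> config -> R) (kappa A B : R) :
    (forall y, 0 < w y) -> 0 <= kappa -> kappa < 1 -> 0 <= A -> 0 <= B ->
    {in Omega S &, forall s t, weighted_hamming w s t <= A * d s t} ->
    {in Omega S &, forall s t, d s t <= B * weighted_hamming w s t} ->
    contractive S (glauber S) d kappa ->
  \sum_(yb : V * 'I_q) `|influence S tau (x, a) yb| * w yb.1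
  <= 2 * (A * B) / ((1 - kappa) * #|V|%:R) * w x.
Proof.
move=> w0 k0 k1 A0 B0 wd dw contr; rewrite influence_row_test.
have V0 : 0 < #|V|%:R :> R by rewrite ltr0n; apply/card_gt0P; exists x.
have -> : 2 * (A * B) / ((1 - kappa) * #|V|%:R) * w x
        = (2 * A) * (B * w x) / ((1 - kappa) * #|V|%:R).
  by field; rewrite gt_eqF // subr_eq0 eq_sym lt_eqF.
have inO s : 0 < m s -> s \in Omega S.
  by move=> ms; apply: (@Omega_pin_sub tau); rewrite inE.
apply: (@tilted_mean_contraction R V 'I_q m _ _ x g _ _ _ d) => //.
- exact: gibbs_pin_ge0.
- exact: gibbs_pin_sum1.
- by move=> s; rewrite divr_ge0 ?ler0n ?ltW.
- by move=> s t; rewrite /g => ->.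
- have p0 : prob m (spin_at x a) != 0 by rewrite gt_eqF.
  rewrite -(mulfV p0) {2}/prob mulr_suml [RHS]big_mkcond; apply: eq_bigr => s _.
  by rewrite /g /spin_at; case: eqP => _; rewrite ?mul1r // !mul0r mulr0.
- by move=> s t ms mt; apply: contr; rewrite ?inE.
- by rewrite mulr_ge0 // ltW.
- move=> s t ms mt /agree_offP st.
  apply: le_trans (dw _ _ (inO _ ms) (inO _ mt)) _.
  rewrite ler_wpM2l // /weighted_hamming big_mkcond (bigD1 x) //= big1.
    by rewrite addr0; case: ifP => // _; rewrite ltW.
  by move=> y yx; rewrite st ?eqxx.
- by rewrite mulr_ge0.
(* The test function is 2-Lipschitz for the weighted Hamming metric, as its
   term at y changes by at most 2 w y, and only if s y != t y. *)
move=> s t ms mt; rewrite -mulrA.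
apply: le_trans (ler_wpM2l _ (wd _ _ (inO _ ms) (inO _ mt))) => //.
rewrite -sumrB /weighted_hamming mulr_sumr [leRHS]big_mkcond.
apply: ler_sum => y _ /=; case: eqP => [->|_] /=; first by rewrite subrr.
rewrite -mulrBr mulrC ler_wpM2r ?(ltW (w0 y)) //.
have sg1 (z : R) : `|Num.sg z| <= 1 by rewrite normr_sg; case: eqP.
have := sg1 (influence S tau (x, a) (y, s y)).
have := sg1 (influence S tau (x, a) (y, t y)).
by rewrite !ler_norml => /andP[? ?] /andP[? ?]; lra.
Qed.

End InfluenceRow.

(** * Spectral independence *)

Lemma contractive_spectrally_independent (w : V -> R)
    (d : config -> config -> R) (kappa A B : R) :
    (forall y, 0 < w y) -> 0 <= kappa -> kappa < 1 -> 0 <= A -> 0 <= B ->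
    {in Omega S &, forall s t, weighted_hamming w s t <= A * d s t} ->
    {in Omega S &, forall s t, d s t <= B * weighted_hamming w s t} ->
    contractive S (glauber S) d kappa ->
  spectrally_independent S (2 * (A * B) / ((1 - kappa) * #|V|%:R)).
Proof.
move=> w0 k0 k1 A0 B0 wd dw contr tau tau_pin lambda.
apply: (@eigenvalue_le_weighted_row_sum _ _ _ (fun i => w (enum_val i).1)) => //.
move=> i; under eq_bigr do rewrite mxE.
have := enum_valP i; case: (enum_val i) => x a; rewrite !inE /= => /andP[_ p0].
apply: le_trans (influence_row_sum tau_pin p0 w0 k0 k1 A0 B0 wd dw contr).
rewrite -(big_enum_val (fun yb => `|influence S tau (x, a) yb| * w yb.1)) /=.
rewrite big_mkcond; apply: ler_sum => yb _; case: ifP => // _.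
by rewrite mulr_ge0 // ltW.
Qed.

End SpectralIndependence.

(** For n = 0 the left-hand side is 0, since division by 0 returns 0. *)
Lemma inv_gap_le (R : realFieldType) (n : nat) (C kappa eps : R) :
  0 <= C -> 0 < eps -> kappa <= 1 - eps / n%:R ->
  C / ((1 - kappa) * n%:R) <= C / eps.
Proof.
move=> C0 eps0; have [->|n0] := posnP n.
  by move=> _; rewrite mulr0n !(mulr0, invr0) divr_ge0 // ltW.
have n1 : 0 < n%:R :> R by rewrite ltr0n.
rewrite lerBrDr addrC -lerBrDr ler_pdivrMr // => le_eps.
by rewrite ler_wpM2l // lef_pV2 // posrE (lt_le_trans eps0).
Qed.

Theorem theorem1p10 (R : realType) (q : nat) (hq : (2 <= q)%N)
    (V dV : finType) (S : spin_system R q V dV)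
    (hOmega : Omega S != set0) (hconn : totally_connected S)
    (kappa : R) (hkappa0 : 0 < kappa) (hkappa1 : kappa < 1) :
  (forall w : V -> R, (forall x, 0 < w x) ->
     contractive S (glauber S) (weighted_hamming w) kappa ->
     let eta := 2 / ((1 - kappa) * #|V|%:R) in
     spectrally_independent S eta /\
     (forall eps : R, 0 < eps -> kappa <= 1 - eps / #|V|%:R -> eta <= 2 / eps))
  /\
  (forall (gamma : R) (d : {ffun V -> 'I_q} -> {ffun V -> 'I_q} -> R),
     1 <= gamma -> equivalent_metric S gamma d ->
     contractive S (glauber S) d kappa ->
     let eta := 2 * gamma ^+ 2 / ((1 - kappa) * #|V|%:R) in
     spectrally_independent S eta /\
     (forall eps : R, 0 < eps -> kappa <= 1 - eps / #|V|%:R ->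
        eta <= 2 * gamma ^+ 2 / eps)).
Proof.
have k0 := ltW hkappa0.
split=> [w w0 contr eta|gamma d gamma1 [_ d_equiv] contr eta].
  split; last by move=> eps; apply: inv_gap_le.
  have -> : eta = 2 * (1 * 1) / ((1 - kappa) * #|V|%:R) by rewrite !mulr1.
  apply: (contractive_spectrally_independent (w := w)) contr => //.
    by move=> s t _ _; rewrite mul1r.
  by move=> s t _ _; rewrite mul1r.
have gamma0 : 0 < gamma by lra.
split; last by move=> eps; apply: inv_gap_le; rewrite mulr_ge0 // exprn_ge0 // ltW.
have hammingE (s t : {ffun V -> 'I_q}) :
    weighted_hamming (fun=> 1) s t = (hamming s t)%:R :> R.
  by rewrite /weighted_hamming sumr_const /hamming cardsE.
rewrite /eta expr2.
apply: (contractive_spectrally_independent (w := fun=> 1)) contr => //;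
  try exact: ltW.
  move=> s t sO tO; rewrite hammingE -ler_pdivrMl //.
  by case/andP: (d_equiv s t sO tO).
by move=> s t sO tO; rewrite hammingE; case/andP: (d_equiv s t sO tO).
Qed.
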